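(* Let $f\ge0$ be integrable on $[-\pi,\pi]$ with $\int_{-\pi}^{\pi} f>0$, and suppose the sequence $\{\sigma_n^2(f)\}_{n\in\mathbb{N}}$ is weakly varying, i.e. $\lim_{n\to\infty}\sigma_{n+1}^2(f)/\sigma_n^2(f)=1$. Let $g$ be a function of the form $$g(\lambda)=h(\lambda)\,|\lambda-\lambda_1|^{\alpha(1)}\cdots|\lambda-\lambda_r|^{\alpha(r)},$$ where $r\in\mathbb{N}$, $\lambda_1,\dots,\lambda_r\in[-\pi,\pi]$, $\alpha(1),\dots,\alpha(r)\ge0$, and $h$ is a measurable function on $[-\pi,\pi]$ which is bounded, continuous at $\lambda=0$, and has a positive lower bound. Then $$\lim_{n\to\infty}\frac{\sigma_n^2(fg)}{\sigma_n^2(f)}=g(0).$$ Moreover, if $g(0)>0$, then $$\lim_{n\to\infty}\frac{\sigma_n^2(fg)}{\mathrm{Var}_{fg}(\widehat m_f)}=1,\qquad\text{where }\ \mathrm{Var}_{fg}(\widehat m_f):=\int_{-\pi}^{\pi}|p_n(e^{i\lambda})|^2f(\lambda)g(\lambda)\,d\lambda .$$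
   Context: For a nonnegative integrable weight $w$ on $[-\pi,\pi]$ with $\int w>0$, $\sigma_n^2(w)=\min_{q\in\mathcal{Q}_n(1)}\int_{-\pi}^{\pi}|q(e^{i\lambda})|^2w(\lambda)\,d\lambda$, where $\mathcal{Q}_n(1)$ is the set of complex polynomials of degree at most $n$ with $q(1)=1$; this is the variance of the BLUE of the mean $m$ of $X(t)=m+Y(t)$ based on $X(0),\dots,X(n)$ when $Y$ has spectral density $w$. The minimizer $p_n=p_n(\cdot,f)\in\mathcal{Q}_n(1)$ for the weight $f$ is unique (the optimal polynomial); its coefficients are those of the BLUE $\widehat m_f$ computed under spectral density $f$, and $\mathrm{Var}_{fg}(\widehat m_f)$ is the variance of this estimator when the true spectral density is $fg$. *)

(* Defs.v *)
From HB Require Import structures.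
From mathcomp Require Import all_boot all_order all_algebra.
From mathcomp Require Import all_classical all_reals all_analysis.
From mathcomp Require complex.
Set Implicit Arguments.
Unset Strict Implicit.
Unset Printing Implicit Defensive.
Import Order.TTheory GRing.Theory Num.Theory.
Import numFieldNormedType.Exports.
Local Open Scope classical_set_scope.
Local Open Scope ring_scope.

Import complex.

Definition Ipi (R : realType) : set R := `[(- pi) , pi]%classic.
Arguments Ipi : clear implicits.

Definition expi (R : realType) (x : R) : R[i] := Complex (cos x) (sin x).

Definition Qn1 (R : realType) (n : nat) : set {poly R[i]} :=
  [set q : {poly R[i]} | (size q <= n.+1)%N /\ q.[1] = 1].
Arguments Qn1 : clear implicits.

Definition qform (R : realType) (q : {poly R[i]}) (w : R -> R) : R :=
  Rintegral (@lebesgue_measure R) (Ipi R)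
    (fun x => (ComplexField.Normc.normc q.[expi x]) ^+ 2 * w x).

Definition sigma2 (R : realType) (n : nat) (w : R -> R) : R :=
  inf [set qform q w | q in Qn1 R n].

(* The optimal polynomial p_n(., f): a minimiser of qform over Q_n(1)
   (it exists and is unique; xget picks it). *)
Definition opt_poly (R : realType) (n : nat) (f : R -> R) : {poly R[i]} :=
  xget 0 [set q : {poly R[i]} | Qn1 R n q /\ forall q', Qn1 R n q' -> qform q f <= qform q' f].

Definition var_est (R : realType) (n : nat) (f g : R -> R) : R :=
  qform (opt_poly n f) (f \* g).

(* Main.v *)
(* Write p_n for the optimal polynomial of f and s_n for sigma_n^2(f).
   Upper bound: with t(z) = (1 + z) / 2 one has t(1) = 1, so p_n t is admissible at
   level n + 1 and the integral of (1 - |t|^2) |p_n|^2 f is at most s_n - s_(n+1) = o(s_n).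
   As |t(e^(i x))|^2 = (1 + cos x) / 2 is 1 only at x = 0, the probability densities
   |p_n|^2 f / s_n concentrate at 0; hence Var_fg / s_n tends to g(0), and
   sigma_n^2(fg) <= Var_fg.
   Lower bound: if U is a polynomial with U(1) = 1 and (g(0) - e) |U|^2 <= g, then q U is
   admissible for every admissible q, so sigma_n^2(fg) >= (g(0) - e) s_(n+k) with
   k = deg U, and s_(n+k) / s_n tends to 1. When g(0) > 0 such a U is a product of powers
   of (z - e^(i lambda_j)) / (1 - e^(i lambda_j)) and a high power of t. *)
Require Import Defs.
From HB Require Import structures.
From mathcomp Require Import all_boot all_order all_algebra.
From mathcomp Require Import all_classical all_reals all_analysis.
From mathcomp Require Import complex measurable_realfun.
From mathcomp Require Import ring lra.
Import Order.TTheory GRing.Theory Num.Theory.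
Import numFieldNormedType.Exports.
Local Open Scope classical_set_scope.
Local Open Scope ring_scope.
Set Implicit Arguments.
Unset Strict Implicit.
Unset Printing Implicit Defensive.

(** * Squared modulus of a complex number *)

(** The squared modulus avoids the square root in [normc], so identities between integrands are
    settled by [ring]. *)
Definition sqmod {R : realType} (z : R[i]) : R := complex.Re z ^+ 2 + complex.Im z ^+ 2.

Lemma normc_sq (R : realType) (z : R[i]) : ComplexField.Normc.normc z ^+ 2 = sqmod z.
Proof. by case: z => a b; rewrite /= sqr_sqrtr // addr_ge0 ?sqr_ge0. Qed.

Lemma sqmod_ge0 (R : realType) (z : R[i]) : 0 <= sqmod z.
Proof. by rewrite addr_ge0 ?sqr_ge0. Qed.

Lemma sqmod1 (R : realType) : sqmod (1 : R[i]) = 1.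
Proof. by rewrite -normc_sq ComplexField.Normc.normc1 expr1n. Qed.

Lemma sqmodM (R : realType) (z t : R[i]) : sqmod (z * t) = sqmod z * sqmod t.
Proof. by case: z t => a b [c d]; rewrite /sqmod /=; ring. Qed.

Lemma sqmodX (R : realType) (z : R[i]) n : sqmod (z ^+ n) = sqmod z ^+ n.
Proof. by elim: n => [|n IH]; rewrite ?sqmod1 // !exprS sqmodM IH. Qed.

(** * Bounded measurable functions and polynomials on the unit circle *)

Definition bounded_measurable {R : realType} (F : R -> R) : Prop :=
  measurable_fun (Ipi R) F /\ exists M, forall x, Ipi R x -> `|F x| <= M.

Lemma measurable_Ipi (R : realType) : measurable (Ipi R).
Proof. exact: measurable_itv. Qed.
#[local] Hint Resolve measurable_Ipi : core.

(* The sigma-algebra of [measurable_Ipi], under the display carried by [lebesgue_measure]. *)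
Lemma measurableTypeR_Ipi (R : realType) : @measurable _ (measurableTypeR R) (Ipi R).
Proof. exact: measurable_Ipi. Qed.
#[local] Hint Resolve measurableTypeR_Ipi : core.

Lemma bounded_measurable_cst (R : realType) (c : R) : bounded_measurable (fun=> c).
Proof. by split; [exact: measurable_cst | exists `|c|]. Qed.

Lemma bounded_measurableD (R : realType) (F G : R -> R) :
  bounded_measurable F -> bounded_measurable G ->
  bounded_measurable (fun x => F x + G x).
Proof.
move=> [mF [M hM]] [mG [N hN]]; split; first exact: measurable_funD.
by exists (M + N) => x Ix; rewrite (le_trans (ler_normD _ _))// lerD ?hM ?hN.
Qed.

Lemma bounded_measurableM (R : realType) (F G : R -> R) :
  bounded_measurable F -> bounded_measurable G ->
  bounded_measurable (fun x => F x * G x).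
Proof.
move=> [mF [M hM]] [mG [N hN]]; split; first exact: measurable_funM.
by exists (M * N) => x Ix; rewrite normrM ler_pM ?hM ?hN.
Qed.

Lemma continuous_bounded_measurable (R : realType) (F : R -> R) :
  continuous F -> bounded_measurable F.
Proof.
move=> cF; split; first by apply: measurable_funTS; exact: continuous_measurable_fun.
have pi2 : - pi <= pi :> R by have := pi_ge0 R; lra.
have cN : {within `[- pi, pi], continuous (fun x => `|F x|)}.
  apply: continuous_subspaceT => x; apply: cvg_norm; exact: cF.
by have [c _ hc] := EVT_max pi2 cN; exists `|F c|.
Qed.

(** Multiplication by e^(i x) mixes real and imaginary parts, so both are carried through one Horner
    induction. *)
Lemma continuous_horner_expi (R : realType) (q : {poly R[i]}) :
  continuous (fun x => complex.Re q.[expi x]) /\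
  continuous (fun x => complex.Im q.[expi x]).
Proof.
have [cc cs] := (@continuous_cos R, @continuous_sin R).
elim/poly_ind: q => [|q c [IHr IHi]].
  by split => x; under eq_fun do rewrite horner0; exact: cvg_cst.
have -> : (fun x => complex.Re (q * 'X + c%:P).[expi x]) =
  fun x => complex.Re q.[expi x] * cos x - complex.Im q.[expi x] * sin x + complex.Re c.
  apply/funext => x; rewrite hornerMXaddC; case: (q.[_]) => a b; case: c => u v /=; ring.
have -> : (fun x => complex.Im (q * 'X + c%:P).[expi x]) =
  fun x => complex.Re q.[expi x] * sin x + complex.Im q.[expi x] * cos x + complex.Im c.
  apply/funext => x; rewrite hornerMXaddC; case: (q.[_]) => a b; case: c => u v /=; ring.
by split => x; (apply: cvgD; last exact: cvg_cst);
  [apply: cvgB | apply: cvgD]; apply: cvgM;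
  do ?[exact: IHr | exact: IHi | exact: cc | exact: cs].
Qed.

Lemma continuous_sqmod_horner (R : realType) (q : {poly R[i]}) :
  continuous (fun x => sqmod q.[expi x]).
Proof.
have [cr ci] := continuous_horner_expi q.
by move=> x; apply: cvgD; apply: cvgM; do ?[exact: cr | exact: ci].
Qed.

Lemma bounded_measurable_horner (R : realType) (q : {poly R[i]}) :
  bounded_measurable (fun x => complex.Re q.[expi x]) /\
  bounded_measurable (fun x => complex.Im q.[expi x]).
Proof.
by have [cr ci] := continuous_horner_expi q; split; exact: continuous_bounded_measurable.
Qed.

Lemma bounded_measurable_sqmod (R : realType) (q : {poly R[i]}) :
  bounded_measurable (fun x => sqmod q.[expi x]).
Proof. by apply: continuous_bounded_measurable; exact: continuous_sqmod_horner. Qed.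

(** * Weights and integrability of the quadratic form *)

Definition weight {R : realType} (w : R -> R) : Prop :=
  (forall x, Ipi R x -> 0 <= w x) /\
  (@lebesgue_measure R).-integrable (Ipi R) (EFin \o w).

Lemma integrable_bounded_measurableM (R : realType) (F w : R -> R) :
  bounded_measurable F -> weight w ->
  (@lebesgue_measure R).-integrable (Ipi R) (EFin \o (fun x => F x * w x)).
Proof.
move=> [mF [M hM]] [_ iw].
have bF : [bounded F x | x in Ipi R].
  exists M; split; first exact: num_real.
  by move=> y My x Ix; apply: le_trans (hM _ Ix) _; exact: ltW.
have mF' : @measurable_fun _ _ (measurableTypeR R) _ (Ipi R) F := mF.
exact: (integrableMr (@measurableTypeR_Ipi R) mF' bF iw).
Qed.

Lemma weightM (R : realType) (w g : R -> R) : weight w -> bounded_measurable g ->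
  (forall x, Ipi R x -> 0 <= g x) -> weight (w \* g).
Proof.
move=> ww bg g0; split; first by move=> x Ix; rewrite mulr_ge0 ?g0 //; case: ww => + _; apply.
have := integrable_bounded_measurableM bg ww.
by under [in X in X -> _]eq_fun do rewrite mulrC.
Qed.

Lemma qformE (R : realType) (q : {poly R[i]}) (w : R -> R) :
  qform q w = Rintegral (@lebesgue_measure R) (Ipi R) (fun x => sqmod q.[expi x] * w x).
Proof. by rewrite /qform; under eq_Rintegral do rewrite normc_sq. Qed.

Lemma integrable_qform (R : realType) (q : {poly R[i]}) (w : R -> R) : weight w ->
  (@lebesgue_measure R).-integrable (Ipi R) (EFin \o (fun x => sqmod q.[expi x] * w x)).
Proof. by apply: integrable_bounded_measurableM; exact: bounded_measurable_sqmod. Qed.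

Lemma integrable_qformZ (R : realType) (c : R) (q : {poly R[i]}) (w : R -> R) : weight w ->
  (@lebesgue_measure R).-integrable (Ipi R)
    (EFin \o (fun x => c * (sqmod q.[expi x] * w x))).
Proof.
move=> ww; under [X in EFin \o X]eq_fun do rewrite mulrA.
apply: integrable_bounded_measurableM => //; apply: bounded_measurableM.
  exact: bounded_measurable_cst.
exact: bounded_measurable_sqmod.
Qed.

Lemma qform_ge0 (R : realType) (q : {poly R[i]}) (w : R -> R) : weight w -> 0 <= qform q w.
Proof.
by move=> [w0 _]; rewrite qformE Rintegral_ge0 // => x Ix; rewrite mulr_ge0 ?sqmod_ge0 ?w0.
Qed.

(** * Orthogonal projection and existence of the optimal polynomial *)

Definition re_inner {R : realType} (z t : R[i]) : R :=
  complex.Re z * complex.Re t + complex.Im z * complex.Im t.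

(* The real part of the sesquilinear form polarising [qform]. *)
Definition bform {R : realType} (w : R -> R) (p q : {poly R[i]}) : R :=
  Rintegral (@lebesgue_measure R) (Ipi R) (fun x => re_inner p.[expi x] q.[expi x] * w x).

Lemma integrable_bform (R : realType) (w : R -> R) (p q : {poly R[i]}) : weight w ->
  (@lebesgue_measure R).-integrable (Ipi R)
    (EFin \o (fun x => re_inner p.[expi x] q.[expi x] * w x)).
Proof.
have [[pr pi] [qr qi]] := (bounded_measurable_horner p, bounded_measurable_horner q).
apply: integrable_bounded_measurableM.
by apply: bounded_measurableD; apply: bounded_measurableM.
Qed.

Lemma bformC (R : realType) (w : R -> R) (p q : {poly R[i]}) : bform w p q = bform w q p.
Proof. by apply: eq_Rintegral => x _; rewrite /re_inner; ring. Qed.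

Lemma bform_qform (R : realType) (w : R -> R) (p : {poly R[i]}) : bform w p p = qform p w.
Proof. by rewrite qformE; apply: eq_Rintegral => x _; rewrite /re_inner /sqmod; ring. Qed.

Lemma bformDr (R : realType) (w : R -> R) (p q r : {poly R[i]}) : weight w ->
  bform w p (q + r) = bform w p q + bform w p r.
Proof.
move=> ww; rewrite /bform -RintegralD //; try exact: integrable_bform.
apply: eq_Rintegral => x _; rewrite hornerD.
by case: q.[_] r.[_] => a b [c d]; rewrite /re_inner /=; ring.
Qed.

Lemma bformZr (R : realType) (w : R -> R) (a : R) (p q : {poly R[i]}) : weight w ->
  bform w p (a%:C%C *: q) = a * bform w p q.
Proof.
move=> ww; rewrite /bform -RintegralZl //; try exact: integrable_bform.
apply: eq_Rintegral => x _; rewrite hornerZ.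
by case: q.[_] => c d; rewrite /re_inner /=; ring.
Qed.

Lemma bformDl (R : realType) (w : R -> R) (p q r : {poly R[i]}) : weight w ->
  bform w (q + r) p = bform w q p + bform w r p.
Proof. by move=> ww; rewrite bformC bformDr // !(bformC w p). Qed.

Lemma bformZl (R : realType) (w : R -> R) (a : R) (p q : {poly R[i]}) : weight w ->
  bform w (a%:C%C *: q) p = a * bform w q p.
Proof. by move=> ww; rewrite bformC bformZr // (bformC w p). Qed.

Lemma qformDZ (R : realType) (w : R -> R) (a : R) (p q : {poly R[i]}) : weight w ->
  qform (p + a%:C%C *: q) w = qform p w + 2 * a * bform w p q + a ^+ 2 * qform q w.
Proof.
move=> ww; rewrite -!bform_qform !(bformDr, bformDl, bformZr, bformZl) //.
by rewrite (bformC w q p); ring.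
Qed.

(* The Cauchy-Schwarz inequality in its degenerate case. *)
Lemma bform_eq0 (R : realType) (w : R -> R) (p q : {poly R[i]}) : weight w ->
  qform q w = 0 -> bform w p q = 0.
Proof.
move=> ww q0; apply/eqP/negPn/negP => b0.
(* The term in a^2 vanishes, and this coefficient gives the quadratic form the value -1. *)
have := qform_ge0 (p + (- (qform p w + 1) / (2 * bform w p q))%:C%C *: q) ww.
rewrite qformDZ // q0 mulr0 addr0.
have -> : 2 * (- (qform p w + 1) / (2 * bform w p q)) * bform w p q = - (qform p w + 1).
  by field.
lra.
Qed.

(** Existence of an orthogonal projection onto [S]. Uniqueness is not asserted, since the form may
    be degenerate. *)
Definition projectable {R : realType} (w : R -> R) (S : {poly R[i]} -> Prop) : Prop :=
  forall p, exists2 s, S s & forall v, S v -> bform w (p - s) v = 0.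

(* One Gram-Schmidt step; a direction of zero norm needs no correction. *)
Lemma projectable_extend (R : realType) (w : R -> R) (S : {poly R[i]} -> Prop)
    (u : {poly R[i]}) : weight w ->
  (forall a s t, S s -> S t -> S (s + (a%:C%C : R[i]) *: t)) ->
  projectable w S ->
  projectable w (fun v => exists2 a : R, S (v - a%:C%C *: u) & True).
Proof.
move=> ww Slin pS p.
have [su Ssu orthu] := pS u; have [sp Ssp orthp] := pS p.
(* [u - su] is the component of [u] orthogonal to [S], and [c] is the coefficient of [p - sp] along
   it. *)
pose c := if qform (u - su) w == 0 then 0 else bform w (p - sp) (u - su) / qform (u - su) w.
have hc : bform w (p - sp) (u - su) = c * qform (u - su) w.
  rewrite /c; case: eqP => [q0|/eqP q0]; first by rewrite q0 mulr0 bform_eq0.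
  by rewrite divfK.
exists (sp + c%:C%C *: (u - su)).
  exists c => //.
  have -> : sp + c%:C%C *: (u - su) - c%:C%C *: u = sp + (- c)%:C%C *: su.
    by rewrite rmorphN -!mul_polyC polyCN; ring.
  exact: Slin.
move=> v [a Sv _].
have e : p - (sp + c%:C%C *: (u - su)) = (p - sp) + (- c)%:C%C *: (u - su).
  by rewrite rmorphN -!mul_polyC polyCN; ring.
(* Splits [v] into an element of [S] and a multiple of the orthogonal direction [u - su]. *)
have -> : v = ((v - a%:C%C *: u) + a%:C%C *: su) + a%:C%C *: (u - su).
  by rewrite -!mul_polyC; ring.
have S1 : S ((v - a%:C%C *: u) + a%:C%C *: su) by exact: Slin.
rewrite e; move: (orthp _ S1) (orthu _ S1) hc.
move: (p - sp) (u - su) (_ + _ *: su) => d t s1 ds ts dt.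
by rewrite bformDl // !(bformDr, bformZr, bformZl) // ds ts bform_qform dt; ring.
Qed.

(** Induction on the degree. Since [bform] is only real bilinear, passing from degree n to n + 1
    adds two real directions, u and i u with u = X^(n+1) - 1, hence two Gram-Schmidt steps. *)
Lemma projectable_root1 (R : realType) (w : R -> R) (n : nat) : weight w ->
  projectable w (fun v => (size v <= n.+1)%N /\ v.[1] = 0).
Proof.
move=> ww; elim: n => [p|n IH].
  exists 0; first by rewrite size_poly0 horner0.
  move=> v [/size1_polyC ->]; rewrite hornerC => ->; rewrite polyC0 -(scale0r 0).
  by rewrite -(rmorph0 (real_complex R)) bformZr // mul0r.
pose S (v : {poly R[i]}) := (size v <= n.+1)%N /\ v.[1] = 0.
have Slin (a : R) s t : S s -> S t -> S (s + (a%:C%C : R[i]) *: t).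
  move=> [ss s1] [st t1]; split; last by rewrite hornerD hornerZ s1 t1 mulr0 addr0.
  by rewrite (leq_trans (size_polyD _ _))// geq_max ss (leq_trans (size_scale_leq _ _)).
pose u : {poly R[i]} := 'X^(n.+1) - 1.
pose T v := exists2 a : R, S (v - a%:C%C *: u) & True.
have Tlin (a : R) s t : T s -> T t -> T (s + (a%:C%C : R[i]) *: t).
  move=> [b Sb _] [c Sc _]; exists (b + a * c) => //.
  have -> : s + a%:C%C *: t - (b + a * c)%:C%C *: u =
      (s - b%:C%C *: u) + a%:C%C *: (t - c%:C%C *: u).
    by rewrite rmorphD rmorphM -!mul_polyC polyCD polyCM; ring.
  exact: Slin.
have := projectable_extend ('i%C *: u) ww Tlin (projectable_extend u ww Slin IH).
congr projectable; apply/funext => v; apply/propext.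
have szu : (size u <= n.+2)%N.
  by rewrite (leq_trans (size_polyD _ _))// size_polyXn size_polyN size_poly1.
have u1 : u.[1] = 0 by rewrite /u !hornerE expr1n subrr.
have e (a b : R) : v - b%:C%C *: ('i%C *: u) - a%:C%C *: u = v - (a +i* b)%C *: u.
  rewrite scalerA -addrA -opprD -scalerDl; congr (_ - _ *: _).
  by apply/eqP; rewrite eq_complex /=; apply/andP; split; apply/eqP; ring.
split=> [[b [a + _] _]|[sv v1]].
  rewrite e => -[sv v1]; split; last first.
    by move: v1; rewrite hornerD hornerN hornerZ u1 mulr0 subr0.
  rewrite -(subrK ((a +i* b)%C *: u) v) (leq_trans (size_polyD _ _))// geq_max.
  by rewrite (leq_trans sv)//= (leq_trans (size_scale_leq _ _)).
(* Subtracting the coefficient of X^(n+1) times [u] lowers the degree and keeps the root at 1. *)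
case E : v`_n.+1 => [a b]; exists b => //; exists a => //; rewrite e -E; split; last first.
  by rewrite hornerD hornerN hornerZ v1 u1 mulr0 subr0.
apply/leq_sizeP => j; rewrite leq_eqVlt => /predU1P[<-|nj].
  by rewrite coefB coefZ coefB coefXn coef1 eqxx subr0 mulr1 subrr.
have vj : v`_j = 0 by exact: (leq_sizeP _ _ sv).
have uj : u`_j = 0 by exact: (leq_sizeP _ _ szu).
by rewrite coefB coefZ vj uj mulr0 subr0.
Qed.

(** Q_n(1) is the translate by 1 of the polynomials of degree at most n vanishing at 1. If s is the
    projection of 1 onto these, Pythagoras makes 1 - s a minimiser. *)
Lemma opt_polyP (R : realType) (w : R -> R) (n : nat) : weight w ->
  Qn1 R n (opt_poly n w) /\ forall q, Qn1 R n q -> qform (opt_poly n w) w <= qform q w.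
Proof.
(* [xget] falls back to its default 0 only when there is no minimiser; that case is refuted by
   exhibiting one. *)
move=> ww; rewrite /opt_poly; case: xgetP => [p _ //|no].
have [s [ss s1] orth] := projectable_root1 n ww 1.
exfalso; apply: (no (1 - s)); split.
  split; last by rewrite hornerD hornerN hornerC s1 subr0.
  by rewrite (leq_trans (size_polyD _ _))// size_polyN size_poly1 geq_max ss.
move=> q [sq q1].
have -> : q = (1 - s) + 1%:C%C *: (q - (1 - s)) by rewrite rmorph1 scale1r addrC subrK.
rewrite qformDZ // orth; last first.
  split; last by rewrite !hornerE q1 s1; ring.
  rewrite (leq_trans (size_polyD _ _))// geq_max sq size_polyN /=.
  by rewrite (leq_trans (size_polyD _ _))// size_polyN size_poly1 geq_max ss.
by rewrite mulr0 addr0 expr1n mul1r lerDl qform_ge0.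
Qed.

(** * Basic properties of the minimal variance *)

Lemma Qn1_1 (R : realType) (n : nat) : Qn1 R n 1.
Proof. by split; rewrite ?hornerC // size_poly1. Qed.

Lemma sigma2_le (R : realType) (w : R -> R) (n : nat) (q : {poly R[i]}) : weight w ->
  Qn1 R n q -> sigma2 n w <= qform q w.
Proof.
move=> ww Qq; apply: ge_inf; last by exists q.
by exists 0 => _ [p _ <-]; exact: qform_ge0.
Qed.

Lemma le_sigma2 (R : realType) (w : R -> R) (n : nat) (m : R) :
  (forall q, Qn1 R n q -> m <= qform q w) -> m <= sigma2 n w.
Proof.
move=> le_m; apply: lb_le_inf; last by move=> _ [q Qq <-]; exact: le_m.
by exists (qform 1 w); exists 1 => //; exact: Qn1_1.
Qed.

Lemma sigma2_opt_poly (R : realType) (w : R -> R) (n : nat) : weight w ->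
  sigma2 n w = qform (opt_poly n w) w.
Proof.
move=> ww; have [Qp minp] := opt_polyP n ww.
by apply/eqP; rewrite eq_le sigma2_le //= le_sigma2.
Qed.

Lemma sigma2_ge0 (R : realType) (w : R -> R) (n : nat) : weight w -> 0 <= sigma2 n w.
Proof. by move=> ww; apply: le_sigma2 => q _; exact: qform_ge0. Qed.

Lemma Qn1M (R : realType) (m n : nat) (p q : {poly R[i]}) :
  Qn1 R m p -> Qn1 R n q -> Qn1 R (m + n) (p * q).
Proof.
move=> [sp p1] [sq q1]; split; last by rewrite hornerM p1 q1 mulr1.
rewrite (leq_trans (size_polyMleq _ _)) //.
by have := leq_add sp sq; rewrite addSn addnS; case: (_ + _)%N.
Qed.

(** * Upper and lower comparison of variances *)

Definition half1X {R : realType} : {poly R[i]} := 2^-1%:C%C *: ('X + 1%:P).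

Lemma sqmod_half1X (R : realType) (x : R) :
  sqmod half1X.[expi x] = (1 + cos x) / 2.
Proof.
rewrite hornerZ hornerD hornerX hornerC /expi /sqmod /=; have := cos2Dsin2 x.
move: (cos x) (sin x) => c s cs; have s2 : s ^+ 2 = 1 - c ^+ 2 by rewrite -cs; ring.
by transitivity (4^-1 * ((c + 1) ^+ 2 + s ^+ 2)); [|rewrite s2]; field.
Qed.

Lemma Qn1_half1X (R : realType) : Qn1 R 1 half1X.
Proof.
split; first by rewrite (leq_trans (size_scale_leq _ _)) // size_XaddC.
rewrite hornerZ hornerD hornerX hornerC; apply/eqP; rewrite eq_complex /=.
by apply/andP; split; apply/eqP; field.
Qed.

(* [p_n half1X] competes for [sigma2 n.+1 f], which forces the mass of [|p_n|^2 f] to sit near 0. *)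
Lemma var_est_ub (R : realType) (f g : R -> R) (e K : R) (n : nat) :
  weight f -> weight (f \* g) -> 0 <= K ->
  (forall x, Ipi R x -> g x <= e + K * ((1 - cos x) / 2)) ->
  var_est n f g <= e * sigma2 n f + K * (sigma2 n f - sigma2 n.+1 f).
Proof.
move=> wf wfg K0 leg; have [Qp _] := opt_polyP n wf.
rewrite (sigma2_opt_poly n wf) /var_est; move: (opt_poly n f) Qp => p Qp.
have le1 : sigma2 n.+1 f <= qform (p * half1X) f.
  by apply: sigma2_le => //; rewrite -addn1; apply: Qn1M => //; exact: Qn1_half1X.
(* This form can be checked under the integral: (1 + cos x)/2 and (1 - cos x)/2 add up to 1, so the
   bound on [g] gives g + K (1 + cos x)/2 <= e + K. *)
suff : qform p (f \* g) + K * qform (p * half1X) f <= (e + K) * qform p f.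
  have := ler_wpM2l K0 le1; lra.
rewrite !qformE -!RintegralZl -?RintegralD //;
  do ?[exact: integrable_qform|exact: integrable_qformZ].
apply: le_Rintegral => //; last 1 first.
- move=> x Ix; rewrite hornerM sqmodM sqmod_half1X /=.
  have f0 : 0 <= f x by case: wf => + _; apply.
  have := ler_wpM2l (mulr_ge0 (sqmod_ge0 p.[expi x]) f0) (leg x Ix).
  lra.
- have := integrableD (@measurableTypeR_Ipi R)
    (integrable_qform p wfg) (integrable_qformZ K (p * half1X) wf).
  exact.
- exact: integrable_qformZ.
Qed.

(** For q admissible at level n, q T is admissible at level n + k; the pointwise bound is multiplied
    by |q|^2 f and integrated. *)
Lemma sigma2_lb (R : realType) (f g : R -> R) (c : R) (n k : nat) (T : {poly R[i]}) :
  weight f -> weight (f \* g) -> Qn1 R k T -> 0 <= c ->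
  (forall x, Ipi R x -> c * sqmod T.[expi x] <= g x) ->
  c * sigma2 (n + k) f <= sigma2 n (f \* g).
Proof.
move=> wf wfg QT c0 leg; apply: le_sigma2 => q Qq.
rewrite (le_trans (ler_wpM2l c0 (sigma2_le wf (Qn1M Qq QT)))) //.
rewrite !qformE -RintegralZl //; last exact: integrable_qform.
apply: le_Rintegral => //; [exact: integrable_qformZ|exact: integrable_qform|].
move=> x Ix; rewrite hornerM sqmodM /=.
have f0 : 0 <= f x by case: wf => + _; apply.
have := ler_wpM2l (mulr_ge0 (sqmod_ge0 q.[expi x]) f0) (leg x Ix).
lra.
Qed.

(** * Limits of ratios for weakly varying sequences *)

(** The ratio telescopes into k consecutive ratios, each tending to 1. *)
Lemma cvg_shift_ratio (R : realType) (s : nat -> R) (k : nat) :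
  (fun n => s n.+1 / s n) @ \oo --> (1 : R) ->
  (fun n => s (n + k)%N / s n) @ \oo --> (1 : R).
Proof.
(* Division by 0 yields 0, so ratios close to 1 force nonzero terms. *)
move=> s1; have snz : \forall n \near \oo, s n != 0.
  apply: filterS (cvgr_neq0 _ s1 (oner_neq0 R)) => n.
  by rewrite mulf_eq0 invr_eq0 negb_or => /andP[].
elim: k => [|k IH].
  apply: cvg_near_cst; near=> n.
  by rewrite addn0 divff //; near: n.
have s1k : (fun n => s (n + k).+1 / s (n + k)%N) @ \oo --> (1 : R).
  have : (fun n => s (n + k).+1 / s (n + k)%N) = (fun n => s n.+1 / s n) \o (addn^~ k) by [].
  move=> ->; apply: (cvg_comp _ _ _ s1); exact: cvg_addnr.
rewrite -[X in _ --> X]mulr1; apply: cvg_trans (cvgM s1k IH); apply: near_eq_cvg.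
near=> n; rewrite /= addnS /GRing.mul_fun /=.
rewrite mulrA divfK //.
near: n; have [N _ hN] := snz; exists N => // m /= Nm; apply: hN => /=.
by rewrite (leq_trans Nm) // leq_addr.
Unshelve. all: by end_near. Qed.

(** After division by s_n the correction K (1 - s_(n+1)/s_n) tends to 0 and s_(n+k)/s_n tends to 1,
    so eventually l - e < u_n/s_n <= v_n/s_n < l + e. *)
Lemma cvg_ratio_squeeze (R : realType) (s u v : nat -> R) (l : R) :
  (forall n, 0 <= s n) -> (forall n, u n <= v n) ->
  (fun n => s n.+1 / s n) @ \oo --> (1 : R) ->
  (forall e, 0 < e -> exists K, forall n,
     v n <= (l + e) * s n + K * (s n - s n.+1)) ->
  (forall e, 0 < e -> exists k, forall n, (l - e) * s (n + k)%N <= u n) ->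
  (fun n => u n / s n) @ \oo --> l /\ (fun n => v n / s n) @ \oo --> l.
Proof.
move=> s0 uv s1 ub lb.
have spos : \forall n \near \oo, 0 < s n.
  apply: filterS (cvgr_neq0 _ s1 (oner_neq0 R)) => n.
  by rewrite mulf_eq0 invr_eq0 negb_or lt0r s0 => /andP[_ ->].
have ubv e : 0 < e -> \forall n \near \oo, v n / s n < l + e.
  (* Half of e goes into the hypothesis; the other half absorbs the vanishing correction. *)
  move=> e0; have e20 : 0 < e / 2 by lra.
  have [K hK] := ub _ e20.
  have c : (fun n => (l + e / 2) + K * (1 - s n.+1 / s n)) @ \oo --> l + e / 2.
    rewrite -[X in _ --> X]addr0; apply: cvgD; first exact: cvg_cst.
    rewrite -(mulr0 K); apply: cvgM; first exact: cvg_cst.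
    by rewrite -(subrr 1); apply: cvgB => //; exact: cvg_cst.
  have lt : l + e / 2 < l + e by lra.
  have := cvgr_lt _ c _ lt; move=> near_lt; near=> n.
  have sn : 0 < s n by near: n.
  apply: (@le_lt_trans _ _ (l + e / 2 + K * (1 - s n.+1 / s n))); last by near: n; exact: near_lt.
  rewrite ler_pdivrMr // (le_trans (hK n)) // [leRHS]mulrDl -[K * _ * _]mulrA.
  by rewrite [_ * s n in leRHS]mulrBl mul1r divfK // gt_eqF.
have lbu e : 0 < e -> \forall n \near \oo, l - e < u n / s n.
  move=> e0; have e20 : 0 < e / 2 by lra.
  have [k hk] := lb _ e20.
  have c : (fun n => (l - e / 2) * (s (n + k)%N / s n)) @ \oo --> l - e / 2.
    rewrite -[X in _ --> X]mulr1; apply: cvgM; first exact: cvg_cst.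
    exact: cvg_shift_ratio.
  have lt : l - e < l - e / 2 by lra.
  have := cvgr_gt _ c _ lt; move=> near_lt; near=> n.
  have sn : 0 < s n by near: n.
  apply: (@lt_le_trans _ _ ((l - e / 2) * (s (n + k)%N / s n))); first by near: n; exact: near_lt.
  by rewrite mulrA ler_pM2r ?invr_gt0 // hk.
have uvs : \forall n \near \oo, u n / s n <= v n / s n.
  by apply: filterS spos => n sn; rewrite ler_pM2r ?invr_gt0.
split; apply/cvgrPdist_lt => e e0; near=> n; rewrite ltr_norml.
  have a1 : l - e < u n / s n by near: n; exact: lbu.
  have a2 : v n / s n < l + e by near: n; exact: ubv.
  have a3 : u n / s n <= v n / s n by near: n.
  by apply/andP; split; lra.
have a1 : l - e < u n / s n by near: n; exact: lbu.
have a2 : v n / s n < l + e by near: n; exact: ubv.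
have a3 : u n / s n <= v n / s n by near: n.
by apply/andP; split; lra.
Unshelve. all: by end_near. Qed.

(** * Estimates for the cosine and for e^(i x) *)

Lemma cos_norm (R : realType) (x : R) : cos `|x| = cos x.
Proof. by case: (ler0P x) => _ //; rewrite cosN. Qed.

Lemma cos_away0 (R : realType) (d : R) : 0 < d ->
  exists rho : R, [/\ 0 <= rho, rho < 1 &
    forall x, Ipi R x -> d <= `|x| -> (1 + cos x) / 2 <= rho].
Proof.
(* Cosine is even and decreasing on [0, pi], so the extreme value is at d. The minimum with pi keeps
   the point in that interval; for d > pi the claim is vacuous. *)
move=> d0; have pi0 := pi_gt0 R; pose m := Num.min d pi.
have m0 : 0 < m by rewrite lt_min d0.
have mpi : m \in `[0, pi] by rewrite in_itv /= ltW // ge_min lexx orbT.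
have cm : cos m < 1.
  by rewrite -(@cos0 R) ltr_cos // in_itv /= lexx ltW.
have cm' := cos_geN1 m.
exists ((1 + cos m) / 2); split; [lra|lra|].
rewrite /Ipi => x /=; rewrite in_itv /= => xpi dx.
suff : cos x <= cos m by lra.
rewrite -cos_norm; have xI : `|x| \in `[0, pi] by rewrite in_itv /= normr_ge0 ler_norml.
have : m <= `|x| by rewrite ge_min dx.
rewrite le_eqVlt => /predU1P[<- //|mx].
by rewrite ltW // ltr_cos.
Qed.

Lemma lipschitz_derive1 (R : realType) (F dF : R -> R) :
  (forall x : R, is_derive x (1 : R) F (dF x)) -> (forall x, `|dF x| <= 1) ->
  forall x y, `|F x - F y| <= `|x - y|.
Proof.
move=> hF dF1; have cF : continuous F.
  by move=> z; apply: differentiable_continuous; apply/derivable1_diffP; case: (hF z).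
have key x y : y < x -> `|F x - F y| <= `|x - y|.
  move=> yx; have [c _ ->] := MVT yx (fun z _ => hF z) (continuous_subspaceT cF).
  by rewrite normrM ler_piMl.
move=> x y; case: (ltgtP x y) => [xy|yx|->]; last by rewrite !subrr.
  by rewrite distrC [leRHS]distrC key.
exact: key.
Qed.

(** Cosine and sine are both 1-Lipschitz; adding the two squares gives the constant 2. *)
Lemma sqmod_expiB (R : realType) (x y : R) :
  sqmod (expi x - expi y) <= 2 * `|x - y| ^+ 2.
Proof.
have hc := lipschitz_derive1 (@is_derive_cos R) _ x y.
have {}hc : `|cos x - cos y| <= `|x - y|.
  by apply: hc => z; rewrite normrN; exact: sin_max.
have hs : `|sin x - sin y| <= `|x - y|.
  by apply: (lipschitz_derive1 (@is_derive_sin R)) => z; exact: cos_max.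
rewrite /sqmod /= -[X in X + _]real_normK ?num_real // -[X in _ + X]real_normK ?num_real //.
by rewrite mulr2n mulrDl mul1r lerD // lerXn2r // nnegrE.
Qed.

(** * The factors |x - l|^a: continuity and polynomial minorants *)

(** For a = 0 the function is constantly 1, including 0^0 = 1. For a > 0 the power is differentiable
    at a positive base, and at x = l the radius e^(1/a) answers the tolerance e. *)
Lemma continuous_powR_norm (R : realType) (l a : R) : 0 <= a ->
  continuous (fun x => `|x - l| `^ a).
Proof.
rewrite le_eqVlt => /predU1P[<- x|a0 x].
  by under eq_fun do rewrite powRr0; exact: cvg_cst.
have cn : `|y - l| @[y --> x] --> `|x - l|.
  by apply: cvg_norm; apply: cvgB => //; exact: cvg_cst.
have [xl|xl] := eqVneq x l.
  rewrite /continuous_at xl subrr normr0 powR0 ?gt_eqF //.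
  apply/cvgrPdist_lt => e e0; rewrite xl subrr normr0 in cn.
  have ea : 0 < e `^ a^-1 by rewrite powR_gt0.
  apply: filterS (cvgr_lt _ cn _ ea) => y ylt.
  rewrite sub0r normrN ger0_norm ?powR_ge0 //.
  have -> : e = (e `^ a^-1) `^ a by rewrite -powRrM mulVf ?gt_eqF // powRr1 // ltW.
  by apply: gt0_ltr_powR => //; rewrite nnegrE ?normr_ge0 // ltW.
have ca : {for `|x - l|, continuous (@powR R ^~ a)}.
  apply: differentiable_continuous; apply/derivable1_diffP; apply: derivable_powR.
  by rewrite in_itv /= andbT normr_gt0 subr_eq0.
exact: (cvg_comp _ _ cn ca).
Qed.

Lemma continuous_big_prod (R : realType) (I : Type) (s : seq I) (F : I -> R -> R) :
  (forall i, continuous (F i)) -> continuous (fun x => \prod_(i <- s) F i x).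
Proof.
move=> cF; elim: s => [|i s IH].
  by under eq_fun do rewrite big_nil; move=> x; exact: cvg_cst.
have -> : (fun x => \prod_(j <- i :: s) F j x) = fun x => F i x * \prod_(j <- s) F j x.
  by apply/funext => x; rewrite big_cons.
by move=> x; apply: cvgM; [exact: cF | exact: IH].
Qed.

Lemma expi_sub1_neq0 (R : realType) (l : R) : Ipi R l -> l != 0 ->
  1 - expi l != 0.
Proof.
move=> lI l0; have nl : 0 < `|l| by rewrite normr_gt0.
have [rho [_ rho1 /(_ l lI (lexx _)) le]] := cos_away0 nl.
rewrite eq_complex negb_and /= subr_eq0; apply/orP; left.
by apply/eqP => c1; move: le; rewrite -c1; lra.
Qed.

(** For l nonzero, a power of (z - e^(i l)) / (1 - e^(i l)) has value 1 at 1 and vanishes at e^(i l)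
    to an order at least that of |x - l|^a. For a = 0 the constant 1 serves. *)
Lemma poly_le_powR_norm (R : realType) (l a : R) : Ipi R l -> 0 <= a ->
  l != 0 \/ a = 0 ->
  exists (T : {poly R[i]}) (C : R), [/\ T.[1] = 1, 0 <= C &
    forall x, Ipi R x -> sqmod T.[expi x] <= C * `|x - l| `^ a].
Proof.
move=> lI a0 [l0|->]; last first.
  exists 1, 1; split; [by rewrite hornerC|by []|].
  by move=> x _; rewrite powRr0 hornerC sqmod1 mulr1.
have u0 := expi_sub1_neq0 lI l0.
(* Chosen so that 2m > a. *)
pose m := (Num.truncn a).+1.
have am : a < (2 * m)%:R.
  by rewrite (lt_le_trans (truncnS_gt a)) // ler_nat leq_pmull.
pose c := (1 - expi l)^-1.
(* The factors come from |e^(i x) - e^(i l)|^2 <= 2 |x - l|^2, from |x - l| <= 2 pi for the surplus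
   exponent 2m - a, and from the normalisation [c]. *)
pose D := 2 ^+ m * (2 * pi) `^ ((2 * m)%:R - a) * sqmod c ^+ m.
exists ((('X - (expi l)%:P) * c%:P) ^+ m), D; split.
- by rewrite horner_exp hornerM !hornerE mulfV // expr1n.
- by rewrite !mulr_ge0 ?powR_ge0 ?exprn_ge0 ?sqmod_ge0.
move=> x xI; rewrite horner_exp hornerM !hornerE sqmodX sqmodM exprMn.
rewrite /D -[leRHS]mulrAC ler_wpM2r ?exprn_ge0 ?sqmod_ge0 //.
rewrite (le_trans (lerXn2r _ _ _ (sqmod_expiB x l))) ?nnegrE ?sqmod_ge0 ?mulr_ge0 //.
rewrite exprMn -exprM -mulrA ler_wpM2l ?exprn_ge0 //.
rewrite -powR_mulrn // -[in leLHS](subrK a (2 * m)%:R) powRD; last first.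
  by rewrite subrK pnatr_eq0.
rewrite ler_wpM2r ?powR_ge0 //; apply: ge0_ler_powR; rewrite ?nnegrE ?normr_ge0 //.
- by rewrite subr_ge0 ltW.
- by rewrite mulr_ge0 // pi_ge0.
move: xI lI; rewrite /Ipi /= !in_itv /= => /andP[x1 x2] /andP[l1 l2].
by rewrite ler_norml; apply/andP; split; lra.
Qed.

Lemma poly_le_prod_powR (R : realType) (r : nat) (lam alpha : 'I_r -> R) :
  (forall j, Ipi R (lam j)) -> (forall j, 0 <= alpha j) ->
  (forall j, lam j != 0 \/ alpha j = 0) ->
  exists (T : {poly R[i]}) (C : R), [/\ T.[1] = 1, 0 <= C &
    forall x, Ipi R x -> sqmod T.[expi x] <= C * \prod_(j < r) (`|x - lam j| `^ alpha j)].
Proof.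
move=> lI a0 la; elim: (index_enum _) => [|j s [T [C [T1 C0 hT]]]].
  exists 1, 1; split; [by rewrite hornerC|by []|].
  by move=> x _; rewrite big_nil hornerC sqmod1 mulr1.
have [U [D [U1 D0 hU]]] := poly_le_powR_norm (lI j) (a0 j) (la j).
exists (U * T), (D * C); split; first by rewrite hornerM U1 T1 mulr1.
  exact: mulr_ge0.
move=> x xI; rewrite big_cons hornerM sqmodM mulrACA ler_pM ?sqmod_ge0 //.
  exact: hU.
exact: hT.
Qed.

(** * Cosine majorant and polynomial minorant of g *)

(** Near 0 continuity suffices. Away from 0, (1 - cos x)/2 >= 1 - rho > 0, so K = M / (1 - rho)
    makes the last term at least the bound M of [g]. *)
Lemma ub_by_cos (R : realType) (g : R -> R) (e : R) : 0 < e ->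
  g x @[x --> (0 : R)] --> g 0 -> (exists M : R, forall x, Ipi R x -> `|g x| <= M) ->
  (forall x, Ipi R x -> 0 <= g x) ->
  exists2 K, 0 <= K & forall x, Ipi R x -> g x <= g 0 + e + K * ((1 - cos x) / 2).
Proof.
move=> e0 cg [M gM] g0.
have I0 : Ipi R 0 by rewrite /Ipi /= in_itv /= oppr_le0 pi_ge0.
have lt : g 0 < g 0 + e by lra.
have : \forall x \near (0 : R), g x < g 0 + e by exact: (cvgr_lt _ cg).
move=> /nbhs_ballP [d /= d0 hd].
have [rho [rho0 rho1 hrho]] := cos_away0 d0.
have M0 : 0 <= M by rewrite (le_trans _ (gM 0 I0)).
exists (M / (1 - rho)); first by rewrite divr_ge0 //; lra.
move=> x xI; have cx := cos_le1 x.
have K0 : 0 <= M / (1 - rho) by rewrite divr_ge0 //; lra.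
have [xd|xd] := ltP `|x| d.
  have := hd x; rewrite /ball /= sub0r normrN => /(_ xd) gx.
  have : 0 <= M / (1 - rho) * ((1 - cos x) / 2) by rewrite mulr_ge0 //; lra.
  lra.
have : M / (1 - rho) * (1 - rho) <= M / (1 - rho) * ((1 - cos x) / 2).
  by rewrite ler_wpM2l //; have := hrho x xI xd; lra.
rewrite divfK; last by rewrite subr_eq0 gt_eqF.
have := gM x xI; have := ler_norm (g x); have := g0 0 I0; lra.
Qed.

(* A high power of [half1X] makes the minorant small away from 0 without changing it at 0. *)
Lemma lb_by_poly (R : realType) (g : R -> R) (T : {poly R[i]}) (C e : R) :
  0 < e -> e <= g 0 -> g x @[x --> (0 : R)] --> g 0 ->
  T.[1] = 1 -> (forall x, Ipi R x -> 0 <= g x) ->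
  (forall x, Ipi R x -> sqmod T.[expi x] <= C * g x) ->
  exists2 U : {poly R[i]}, U.[1] = 1 &
    forall x, Ipi R x -> (g 0 - e) * sqmod U.[expi x] <= g x.
Proof.
move=> e0 eg cg T1 g0 hT.
have c0 : 0 <= g 0 - e by lra.
have expi0 : expi 0 = 1 :> R[i] by rewrite /expi cos0 sin0.
have cF : (g x - (g 0 - e) * sqmod T.[expi x]) @[x --> (0:R)] --> g 0 - (g 0 - e) * 1.
  apply: cvgB => //; apply: cvgM; first exact: cvg_cst.
  have := @continuous_sqmod_horner R T (0 : R).
  by rewrite /continuous_at expi0 T1 sqmod1.
(* The slack e at 0 leaves a neighbourhood where [T] alone is already a minorant. *)
have F0 : 0 < g 0 - (g 0 - e) * 1 by lra.
have : \forall x \near (0 : R), 0 < g x - (g 0 - e) * sqmod T.[expi x].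
  by exact: (cvgr_gt _ cF).
move=> /nbhs_ballP [d /= d0 hd].
have [rho [rho0 rho1 hrho]] := cos_away0 d0.
(* Outside that neighbourhood the damping rho^N must absorb the constant (g(0) - e) |C|. *)
have [N hN] : exists N, ((g 0 - e) * `|C|) * rho ^+ N <= 1.
  have : (fun N => ((g 0 - e) * `|C|) * rho ^+ N) @ \oo --> ((g 0 - e) * `|C|) * 0.
    by apply: cvgM; [exact: cvg_cst | apply: cvg_expr; rewrite ger0_norm].
  rewrite mulr0 => cN; have [N _ hN] := cvgr_lt _ cN _ ltr01.
  by exists N; apply: ltW; apply: hN => /=.
exists (T * half1X ^+ N).
  by have [_ h1] := Qn1_half1X R; rewrite hornerM horner_exp h1 T1 expr1n mulr1.
move=> x xI; rewrite hornerM horner_exp sqmodM sqmodX sqmod_half1X.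
have [c1 c2] := (cos_geN1 x, cos_le1 x).
have t0 : 0 <= (1 + cos x) / 2 by lra.
have t1 : (1 + cos x) / 2 <= 1 by lra.
have [xd|xd] := ltP `|x| d.
  have := hd x; rewrite /ball /= sub0r normrN => /(_ xd) gx.
  rewrite mulrA; apply: (@le_trans _ _ ((g 0 - e) * sqmod T.[expi x])); last by lra.
  by rewrite ler_piMr ?exprn_ile1 // mulr_ge0 // sqmod_ge0.
have gx := g0 x xI.
apply: (@le_trans _ _ ((g 0 - e) * (`|C| * g x * rho ^+ N))).
  rewrite ler_wpM2l // ler_pM ?sqmod_ge0 ?exprn_ge0 //.
    by rewrite (le_trans (hT x xI)) // ler_wpM2r // ler_norm.
  by rewrite lerXn2r ?nnegrE // hrho.
have := ler_wpM2r gx hN; rewrite mul1r; apply: le_trans.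
by rewrite le_eqVlt; apply/orP; left; apply/eqP; ring.
Qed.

(** * Assembly of the two limits *)

Theorem theorem5p12 (R : realType) (f : R -> R)
  (f_ge0 : forall x, Ipi R x -> 0 <= f x)
  (f_int : (@lebesgue_measure R).-integrable (Ipi R) (EFin \o f))
  (f_pos : (0 < \int[@lebesgue_measure R]_(x in Ipi R) (f x)%:E)%E)
  (f_wv : (fun n => sigma2 n.+1 f / sigma2 n f) @ \oo --> (1 : R))
  (r : nat) (lam alpha : 'I_r -> R) (h : R -> R)
  (lam_in : forall j, Ipi R (lam j))
  (alpha_ge0 : forall j, 0 <= alpha j)
  (h_meas : measurable_fun (Ipi R) h)
  (h_bdd : exists M : R, forall x, Ipi R x -> `|h x| <= M)
  (h_cont0 : h x @[x --> (0 : R)] --> h 0)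
  (h_lb : exists c : R, 0 < c /\ forall x, Ipi R x -> c <= h x)
  (g : R -> R)
  (g_def : forall x, g x = h x * \prod_(j < r) (`|x - lam j| `^ alpha j)) :
  ((fun n => sigma2 n (f \* g) / sigma2 n f) @ \oo --> g 0) /\
  (0 < g 0 -> (fun n => sigma2 n (f \* g) / var_est n f g) @ \oo --> (1 : R)).
Proof.
have wf : weight f by split.
have [c [c0 hc]] := h_lb.
pose P (x : R) := \prod_(j < r) (`|x - lam j| `^ alpha j).
have P0 x : 0 <= P x by apply: prodr_ge0 => j _; exact: powR_ge0.
have cP : continuous P.
  by apply: continuous_big_prod => j; exact: continuous_powR_norm.
have gE : g = fun x => h x * P x by apply/funext => x; exact: g_def.
have g0 x : Ipi R x -> 0 <= g x.
  by move=> xI; rewrite gE mulr_ge0 // (le_trans (ltW c0)) // hc.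
have bg : bounded_measurable g.
  by rewrite gE; apply: bounded_measurableM => //; exact: continuous_bounded_measurable.
have cg : g x @[x --> (0 : R)] --> g 0 by rewrite gE; apply: cvgM => //; exact: cP.
have wfg : weight (f \* g) by exact: weightM.
have lb e : 0 < e -> exists k, forall n,
    (g 0 - e) * sigma2 (n + k) f <= sigma2 n (f \* g).
  (* If e > g(0) the left side is nonpositive; in particular this settles g(0) = 0. *)
  move=> e0; have [eg|ge] := leP e (g 0); last first.
    exists 0%N => n; apply: (@le_trans _ _ 0); last exact: sigma2_ge0.
    by rewrite nmulr_rle0 ?sigma2_ge0 //; lra.
  have gpos : 0 < g 0 by lra.
  (* A zero of positive order at 0 would make g(0) vanish. *)
  have la j : lam j != 0 \/ alpha j = 0.
    have : P 0 != 0.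
      by apply: contraTneq gpos => Pz; rewrite gE Pz mulr0 ltxx.
    move=> /prodf_neq0 /(_ j isT); rewrite powR_eq0 sub0r normrN normr_eq0 negb_and negbK.
    by case/orP => [|/eqP]; [left | right].
  have [T [C [T1 C0 hT]]] := poly_le_prod_powR lam_in alpha_ge0 la.
  (* As h >= c, the product of powers is at most g / c. *)
  have hTg x : Ipi R x -> sqmod T.[expi x] <= (C / c) * g x.
    move=> xI; rewrite (le_trans (hT x xI)) // gE -mulrA ler_wpM2l // mulrA.
    by apply: ler_peMl; [exact: P0 | rewrite mulrC ler_pdivlMr // mul1r hc].
  have [U U1 hU] := lb_by_poly e0 eg cg T1 g0 hTg.
  (* The size exceeds the degree of [U], so [U] lies in Q_k(1) for k = [size U]. *)
  exists (size U) => n; apply: (@sigma2_lb R f g (g 0 - e) n (size U) U) => //; lra.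
have ub e : 0 < e -> exists K, forall n,
    var_est n f g <= (g 0 + e) * sigma2 n f + K * (sigma2 n f - sigma2 n.+1 f).
  move=> e0; have [_ gM] := bg; have [K K0 hK] := ub_by_cos e0 cg gM g0.
  by exists K => n; exact: var_est_ub.
have le n : sigma2 n (f \* g) <= var_est n f g.
  by apply: sigma2_le => //; have [] := opt_polyP n wf.
have [lim_u lim_v] := cvg_ratio_squeeze (fun n => sigma2_ge0 n wf) le f_wv ub lb.
split=> // gpos.
have gnz : g 0 != 0 by rewrite gt_eqF.
rewrite -(divff gnz).
(* The quotient of the two limits is g(0)/g(0) = 1; the common factor s_n cancels where it is
   nonzero, hence eventually. *)
apply: cvg_trans (cvgM lim_u (cvgV gnz lim_v)); apply: near_eq_cvg.
have snz : \forall n \near \oo, sigma2 n f != 0.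
  apply: filterS (cvgr_neq0 _ f_wv (oner_neq0 R)) => n.
  by rewrite mulf_eq0 invr_eq0 negb_or => /andP[].
near=> n; rewrite /GRing.mul_fun /= invf_div mulrA divfK //.
by near: n.
Unshelve. all: by end_near. Qed.
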